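(* Let $\widehat\Sigma\in\mathbb{R}^{n\times n}$ be symmetric strictly positive definite and let $\Sigma=\begin{pmatrix}\Sigma_{11}&\Sigma_{12}\\ \Sigma_{21}&\Sigma_{22}\end{pmatrix}\in\mathbf\Sigma$ be a strictly positive definite covariance matrix. The problem $\min_{\Sigma_0\in\mathbf\Sigma_0}\mathcal I(\Sigma_0\|\Sigma)$ has a unique minimizer, given by $$\Sigma^*=\begin{pmatrix}\widehat\Sigma&\widehat\Sigma\,\Sigma_{11}^{-1}\Sigma_{12}\\ \Sigma_{21}\Sigma_{11}^{-1}\widehat\Sigma&\Sigma_{22}-\Sigma_{21}\Sigma_{11}^{-1}(\Sigma_{11}-\widehat\Sigma)\Sigma_{11}^{-1}\Sigma_{12}\end{pmatrix},$$ and $\Sigma^*$ is strictly positive definite. Moreover $$\mathcal I(\Sigma^*\|\Sigma)=\mathcal I(\widehat\Sigma\|\Sigma_{11}),$$ and the Pythagorean rule $$\mathcal I(\Sigma_0\|\Sigma)=\mathcal I(\Sigma_0\|\Sigma^* )+\mathcal I(\Sigma^*\|\Sigma)$$ holds for any strictly positive definite $\Sigma_0\in\mathbf\Sigma_0$.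
   Context: For two covariance (symmetric nonnegative definite) matrices $\Sigma_1,\Sigma_2$ of the same size $m\times m$, $\mathcal I(\Sigma_1\|\Sigma_2)$ denotes the I-divergence (Kullback-Leibler divergence) of $N(0,\Sigma_1)$ with respect to $N(0,\Sigma_2)$ ($+\infty$ if the first law is not absolutely continuous with respect to the second). If both matrices are strictly positive definite, $\mathcal I(\Sigma_1\|\Sigma_2)=\frac12\log\frac{|\Sigma_2|}{|\Sigma_1|}-\frac m2+\frac12\mathrm{tr}(\Sigma_2^{-1}\Sigma_1)$. $n,k$ are positive integers with $k<n$. $\mathbf\Sigma$ is the set of all $(n+k)\times(n+k)$ covariance matrices, written in blocks with $\Sigma_{11}$ of size $n\times n$ and $\Sigma_{22}$ of size $k\times k$. $\mathbf\Sigma_0=\{\Sigma\in\mathbf\Sigma:\Sigma_{11}=\widehat\Sigma\}$. *)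

(* Defs.v *)
From HB Require Import structures.
From mathcomp Require Import all_boot all_order all_algebra.
From mathcomp Require Import all_classical all_reals all_analysis.
From mathcomp Require Import measurable_realfun ring lra.

Set Implicit Arguments.
Unset Strict Implicit.
Unset Printing Implicit Defensive.

Import Order.TTheory GRing.Theory Num.Theory.
Import numFieldNormedType.Exports.

Local Open Scope classical_set_scope.
Local Open Scope ring_scope.

Definition psdmx (R : realType) (m : nat) (S : 'M[R]_m) : Prop :=
  S^T = S /\ forall x : 'cV[R]_m, 0 <= (x^T *m S *m x) 0 0.

Definition posdefmx (R : realType) (m : nat) (S : 'M[R]_m) : Prop :=
  S^T = S /\ forall x : 'cV[R]_m, x != 0 -> 0 < (x^T *m S *m x) 0 0.

Lemma psdmx_root (R : realType) (m : nat) (S : 'M[R]_m) :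
  psdmx S -> exists A : 'M[R]_m, A *m A^T = S.
Proof.
elim: m S => [|m IH] S; first by exists 0; apply/matrixP => -[].
rewrite -[m.+1]/(1 + m)%N in S *; move=> [symS posS].
pose a := S 0 0; pose b := dlsubmx S; pose C := drsubmx S.
have Sul : ulsubmx S = a%:M.
  by rewrite [LHS]mx11_scalar !mxE /a; congr (S _ _)%:M; exact/val_inj.
have Sur : ursubmx S = b^T by rewrite /b trmx_dlsub symS.
have SE : S = block_mx a%:M b^T b C by rewrite -Sul -Sur submxK.
have Csym : C^T = C by rewrite /C trmx_drsub symS.
clearbody a b C; clear Sul Sur.
have qf (t : R) (y : 'cV[R]_m) : 0 <=
    (t ^+ 2 * a + t * (y^T *m b) 0 0 *+ 2 + (y^T *m C *m y) 0 0).
  have := posS (col_mx t%:M y).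
  rewrite SE tr_col_mx mul_row_block mul_row_col !mulmxDl tr_scalar_mx.
  have -> : t%:M *m b^T *m y = t *: (y^T *m b).
    rewrite mul_scalar_mx -scalemxAl -[b^T *m y]trmxK trmx_mul trmxK.
    by rewrite [(y^T *m b)]mx11_scalar tr_scalar_mx.
  rewrite -!scalar_mxM mul_mx_scalar !mxE !mulr1n => h.
  by apply: le_trans h _; rewrite le_eqVlt; apply/orP; left; apply/eqP; ring.
have [a0|an0] := eqVneq a 0.
  have b0 : b = 0.
    apply/eqP/negPn/negP => bn0.
    have bb : 0 < (b^T *m b) 0 0.
      have /existsP[i bi] : [exists i, b i 0 != 0].
        apply: contraNT bn0; rewrite negb_exists => /forallP h.
        by apply/eqP/matrixP => i j; rewrite ord1 mxE; apply/eqP; move: (h i); rewrite negbK.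
      rewrite mxE.
      rewrite (bigD1 i)//= ltr_pwDl//.
        by rewrite mxE -expr2 lt_def sqr_ge0 expf_neq0.
      by apply: sumr_ge0 => j _; rewrite mxE -expr2 sqr_ge0.
    pose q := (b^T *m C *m b) 0 0.
    have := qf (- (q + 1) / (b^T *m b) 0 0) b.
    rewrite a0 mulr0 add0r divfK ?gt_eqF// -/q mulr2n.
    have q0 : 0 <= q.
      by have := qf 0 b; rewrite expr2 !mul0r mul0rn !add0r.
    by rewrite leNgt -addrA opprD -!addrA => /negP; apply; rewrite -/q; lra.
  have [] := IH C.
    split=> // y; have := qf 0 y.
    by rewrite expr2 !mul0r mul0rn !add0r.
  move=> L LE; exists (block_mx 0 0 0 L : 'M[R]_(1 + m)).
  rewrite SE tr_block_mx mulmx_block !trmx0 !mul0mx !mulmx0 !add0r LE a0 b0.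
  by rewrite trmx0 raddf0.
have a_gt0 : 0 < a.
  rewrite lt_def an0; have := qf 1 0.
  by rewrite trmx0 !mul0mx !mxE mulr0 mul0rn !addr0 expr1n mul1r.
have [] := IH (C - a^-1 *: (b *m b^T)).
  split.
    by rewrite linearB linearZ /= trmx_mul trmxK Csym.
  move=> y; have := qf (- a^-1 * (y^T *m b) 0 0) y.
  have -> : y^T *m (C - a^-1 *: (b *m b^T)) *m y
     = y^T *m C *m y - (a^-1 * (y^T *m b) 0 0 ^+2 )%:M.
    rewrite mulmxBr mulmxBl; congr (_ - _).
    rewrite -scalemxAr -scalemxAl (mulmxA y^T) -(mulmxA (y^T *m b)).
    have -> : b^T *m y = y^T *m b.
      rewrite -[b^T *m y]trmxK trmx_mul trmxK.
      by rewrite [(y^T *m b)]mx11_scalar tr_scalar_mx.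
    by rewrite [(y^T *m b)]mx11_scalar -scalar_mxM scale_scalar_mx !mxE !mulr1n expr2.
  have subE (B : 'M[R]_1) c : (B - c%:M) 0 0 = B 0 0 - c by rewrite !mxE mulr1n.
  rewrite subE.
  set u := (y^T *m b) 0 0; set v := (_ *m C *m y) 0 0 => h.
  apply: le_trans h _; rewrite le_eqVlt; apply/orP; left; apply/eqP.
  by rewrite mulr2n; field.
move=> L LE; exists (block_mx (Num.sqrt a)%:M 0 ((Num.sqrt a)^-1 *: b) L : 'M[R]_(1 + m)).
have sn0 : Num.sqrt a != 0 by rewrite gt_eqF// sqrtr_gt0.
have s2 : Num.sqrt a * Num.sqrt a = a by rewrite -expr2 sqr_sqrtr// ltW.
rewrite tr_block_mx mulmx_block !trmx0 !mul0mx !mulmx0 !addr0 LE SE.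
rewrite tr_scalar_mx -scalar_mxM s2 linearZ /= mul_scalar_mx scalerA mulfV// scale1r.
rewrite mul_mx_scalar scalerA mulfV// scale1r -scalemxAl -scalemxAr scalerA -invfM s2.
by rewrite addrC subrK.
Qed.

Section product_probability.
Context d1 d2 (T1 : measurableType d1) (T2 : measurableType d2) (R : realType).
Variables (P1 : probability T1 R) (P2 : probability T2 R).
Local Open Scope ereal_scope.

Definition prod_prob : set (T1 * T2) -> \bar R := P1 \x P2.

HB.instance Definition _ := Measure.on prod_prob.

Let prod_prob_setT : prod_prob [set: T1 * T2] = 1.
Proof.
rewrite -setXTT; transitivity (P1 [set: T1] * P2 [set: T2]).
  exact: product_measure1E.
by rewrite !probability_setT mule1.
Qed.

HB.instance Definition _ :=
  Measure_isProbability.Build _ _ _ prod_prob prod_prob_setT.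

End product_probability.

Section gaussian.
Variable R : realType.
Local Notation RT := (measurableTypeR R).

Definition tcons (m : nat) (x : RT * m.-tuple RT) : m.+1.-tuple RT :=
  [tuple of x.1 :: x.2].

Lemma measurable_tcons (m : nat) :
  measurable_fun [set: RT * m.-tuple RT] (@tcons m).
Proof. exact: measurable_cons. Qed.

HB.instance Definition _ (m : nat) :=
  isMeasurableFun.Build _ _ _ _ (@tcons m) (@measurable_tcons m).

Definition linmap (m : nat) (A : 'M[R]_m) (x : m.-tuple RT) : m.-tuple RT :=
  [tuple \sum_(j < m) A i j * tnth x j | i < m].

Lemma measurable_linmap (m : nat) (A : 'M[R]_m) :
  measurable_fun [set: m.-tuple RT] (linmap A).
Proof.
apply/measurable_fun_tnthP => i.
rewrite (_ : _ \o _ = fun x => \sum_(j < m) A i j * tnth x j).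
  apply: measurable_sum => j; apply: measurable_funM => //.
  exact: measurable_tnth.
by apply/funext => x /=; rewrite tnth_mktuple.
Qed.

HB.instance Definition _ (m : nat) (A : 'M[R]_m) :=
  isMeasurableFun.Build _ _ _ _ (linmap A) (@measurable_linmap m A).

Fixpoint std_gaussian (m : nat) : probability (m.-tuple RT) R :=
  match m with
  | 0 => dirac ([tuple] : 0.-tuple RT)
  | m'.+1 =>
      distribution (prod_prob (normal_prob 0 1) (std_gaussian m')) (@tcons m')
  end.

(** [N(0,S)] is the law of [A Z], with [Z] standard Gaussian on [R^m] and
    [A A^T = S]; singular [S] are allowed. That law depends on [A] only through
    [A A^T], so it does not matter which root [A] is picked. *)
Definition covroot (m : nat) (S : 'M[R]_m) : 'M[R]_m :=
  xget 0 [set A | A *m A^T = S].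

Lemma covrootE (m : nat) (S : 'M[R]_m) :
  psdmx S -> covroot S *m (covroot S)^T = S.
Proof.
move=> /psdmx_root[A AS].
by rewrite /covroot; case: xgetP => [B _ ->//|/(_ A)].
Qed.

Definition gaussian (m : nat) (S : 'M[R]_m) : probability (m.-tuple RT) R :=
  distribution (std_gaussian m) (linmap (covroot S)).

End gaussian.

(** [ln] is [0] on nonpositive reals, a convention that is harmless here: the
    density [dP/dQ] is positive [P]-almost everywhere. *)
Definition KL d (T : measurableType d) (R : realType) (P Q : probability T R) :
    \bar R :=
  if `[< P `<< Q >] then
    (\int[P]_x (ln (fine (Radon_Nikodym (charge_of_finite_measure P) Q x)))%:E)%E
  else +oo%E.

Definition Idiv (R : realType) (m : nat) (S1 S2 : 'M[R]_m) : \bar R :=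
  KL (gaussian S1) (gaussian S2).

Definition argmins (T : Type) (R : realType) (A : set T) (f : T -> \bar R) :
    set T :=
  [set x | A x /\ forall y, A y -> (f x <= f y)%E].

Definition Sigma0 (R : realType) (n k : nat) (Sh : 'M[R]_n) :
    set 'M[R]_(n + k) :=
  [set S | psdmx S /\ ulsubmx S = Sh].
Arguments Sigma0 {R n} k Sh _.

(* Main.v *)
Require Import Defs.
From HB Require Import structures.
From mathcomp Require Import all_boot all_order all_algebra.
From mathcomp Require Import all_classical all_reals all_analysis.
From mathcomp Require Import measurable_realfun ring lra.

Set Implicit Arguments.
Unset Strict Implicit.
Unset Printing Implicit Defensive.

Import Order.TTheory GRing.Theory Num.Theory.

Local Open Scope classical_set_scope.
Local Open Scope ring_scope.

(** The divergence of two nondegenerate centred Gaussian laws is given by the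
    determinant-trace formula [Idiv_posdef], and a singular law has infinite
    divergence from a nondegenerate one, since it lives on a hyperplane that the
    other does not charge ([Idiv_singular]). What remains is linear algebra.

    Write [K = S21 S11^-1] for the regression coefficient and [W] for the Schur
    complement of [S11]. Then [S = U diag(S11, W) U^T] with [U] the shear
    [1 0; K 1] ([schur_decomposition]), and [Sstar = U diag(Sh, W) U^T]: the
    minimizer has the prescribed marginal and keeps the conditional law of the
    second block. Divergence is invariant under a common change of coordinates
    ([Idiv_congr]), and undoing the shear leaves the upper left block [Sh] of a
    competitor unchanged, so it is enough to compare [diag(S11, W)] with
    [diag(Sh, W)]. Against a block diagonal matrix the log-determinant and the
    trace split, the contribution of [W] is the same on both sides, and the
    difference is the divergence of the marginals ([Idiv_block_diag]). This is
    the Pythagorean rule, and the value at [Sstar] is its special case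
    [S0 = Sstar]. Uniqueness follows from the strict inequality
    [ln (det X) < tr X - m] for positive definite [X] other than the identity
    ([ln_det_le_trace]).

    The law [N(0, S)] is defined as the image of the standard Gaussian under
    some root of [S], so the formula requires the density of a linear image
    [A Z]. The change of variables formula is proved with respect to the
    standard Gaussian measure instead of Lebesgue measure
    ([changes_variables_unit]): every invertible matrix is a product of block
    triangular factors, each of which acts on one coordinate for fixed values
    of the others, or the reverse, so that the theorem of Tonelli and induction
    on the dimension suffice. The formula depends on [A] only through [A A^T].
    It also yields the second moments of the standard Gaussian, hence the
    expectation of a quadratic form ([std_gaussian_form]). *)

(** * Affine change of variables on the real line *)

(** The density [g] agrees almost everywhere with the Radon-Nikodym derivative,
    for which the change of measure is known. *)
Lemma ge0_integral_density d (T : measurableType d) (R : realType)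
    (nu : {finite_measure set T -> \bar R})
    (mu : {sigma_finite_measure set T -> \bar R}) (g : T -> R)
    (f : T -> \bar R) :
  measurable_fun setT g -> (forall x, 0 <= g x) ->
  (forall A, measurable A -> nu A = \int[mu]_(x in A) (g x)%:E)%E ->
  measurable_fun setT f -> (forall x, (0 <= f x)%E) ->
  (\int[nu]_x f x = \int[mu]_x (f x * (g x)%:E))%E.
Proof.
move=> mg g0 nuE mf f0.
have mgE : measurable_fun setT (EFin \o g) by exact/measurable_EFinP.
have numu : nu `<< mu.
  apply/null_content_dominatesP => A mA muA.
  by rewrite nuE// null_set_integral//; exact: measurable_funTS.
rewrite -(Radon_Nikodym_SigmaFinite.change_of_variables numu f0 measurableT mf).
set h := Radon_Nikodym_SigmaFinite.f nu mu.
have ih : mu.-integrable setT h := Radon_Nikodym_SigmaFinite.f_integrable numu.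
apply: ae_eq_integral => //; first 1 last.
- exact: emeasurable_funM.
- apply: ae_eqe_mul2l; apply: integral_ae_eq => // E _ mE.
  by rewrite -nuE// -Radon_Nikodym_SigmaFinite.f_integral.
- by apply: emeasurable_funM => //; exact: measurable_int ih.
Qed.

(** Lebesgue measure is determined by its values on half-open intervals, and
    the preimage of such an interval is one whose length is divided by [a]. *)
Lemma ge0_integral_scale_shift (R : realType) (a c : R) (f : R -> \bar R) :
  0 < a -> measurable_fun [set: R] f -> (forall x, (0 <= f x)%E) ->
  (\int[lebesgue_measure]_x f (a * x + c)%R =
   (a^-1)%:E * \int[lebesgue_measure]_x f x)%E.
Proof.
move=> a0 mf f0; pose RT := measurableTypeR R.
pose phi : RT -> RT := fun x => a * x + c.
have mphi : measurable_fun [set: RT] phi.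
  by apply: measurable_funD => //; exact: measurable_funM.
pose phi_pack : {mfun RT >-> RT} := HB.pack phi (isMeasurableFun.Build _ _ _ _ _ mphi).
have a0' : 0 <= a^-1 by rewrite invr_ge0 ltW.
rewrite -[a^-1]/((NngNum a0')%:num) -ge0_integral_mscale//.
rewrite -[LHS](@ge0_integral_pushforward _ _ RT RT R phi mphi lebesgue_measure setT f)//.
apply: eq_measure_integral => /= A mA _.
have := @lebesgue_measure_unique R (mscale (NngNum (ltW a0)) (pushforward lebesgue_measure phi_pack)).
rewrite /mscale/= => -> //; first by rewrite muleA -EFinM mulVf ?mul1e ?gt_eqF.
move=> _ [[u v]] _ <- /=.
transitivity (a%:E * lebesgue_measure (phi @^-1` `]u, v]%classic))%E; last by [].
have -> : phi @^-1` `]u, v]%classic = `](u - c) / a, (v - c) / a]%classic.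
  by apply/seteqP; split=> x /=; rewrite /phi !in_itv/= ltr_pdivrMr// ler_pdivlMr// ltrBlDr lerBrDr mulrC.
rewrite !lebesgue_measure_itv/= !lte_fin ltr_pM2r ?invr_gt0// ltrD2r.
case: ifP => _; last by rewrite mule0.
by rewrite -EFinD -EFinM; congr (_%:E); field; rewrite gt_eqF.
Qed.

Lemma ge0_integral_affine (R : realType) (a c : R) (f : R -> \bar R) :
  a != 0 -> measurable_fun [set: R] f -> (forall x, (0 <= f x)%E) ->
  (\int[lebesgue_measure]_x f (a * x + c)%R =
   (`|a|^-1)%:E * \int[lebesgue_measure]_x f x)%E.
Proof.
move=> a0 mf f0; have [a_gt0|a_lt0|/eqP] := ltgtP 0 a; last by rewrite eq_sym (negbTE a0).
  by rewrite gtr0_norm// ge0_integral_scale_shift.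
rewrite ltr0_norm//; have na0 : 0 < - a by rewrite oppr_gt0.
rewrite -(ge0_integral_scale_shift c na0 mf f0).
have mg : measurable_fun [set: R] (fun x => f (- a * x + c)).
  by apply: measurableT_comp => //; apply: measurable_funD => //; exact: measurable_funM.
transitivity (\int[lebesgue_measure]_x ((fun x : R => f (- a * x + c)%R) \o (-%R : R -> R)) x)%E.
  by apply: eq_integral => x _ /=; rewrite mulrNN.
rewrite -[LHS](@ge0_integral_pushforward _ _ (measurableTypeR R)
  (measurableTypeR R) R (-%R : R -> R) _ lebesgue_measure setT (fun x => f (- a * x + c)))//.
by apply: eq_measure_integral => /= A mA _; exact: lebesgue_measureN.
Qed.

Lemma ge0_integral_normal (R : realType) (f : measurableTypeR R -> \bar R) :
  measurable_fun setT f -> (forall x, (0 <= f x)%E) ->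
  (\int[normal_prob (0 : R) 1]_x f x =
   \int[lebesgue_measure]_x (f x * (normal_pdf 0 1 x)%:E))%E.
Proof.
move=> mf f0; apply: ge0_integral_density => //.
- exact: measurable_normal_pdf.
- exact: normal_pdf_ge0.
Qed.

(** Lebesgue measure cancels out of this form of the affine change of
    variables, which makes it stable under products of measures. *)
Lemma ge0_integral_normal_affine (R : realType) (a c : R)
    (f : measurableTypeR R -> \bar R) :
  a != 0 -> measurable_fun setT f -> (forall x, (0 <= f x)%E) ->
  (\int[normal_prob (0 : R) 1]_x f (a * x + c)%R =
   \int[normal_prob (0 : R) 1]_x
     (f x * (`|a|^-1 * expR ((x ^+ 2 - (a^-1 * (x - c)) ^+ 2) / 2))%:E))%E.
Proof.
move=> a0 mf f0.
pose g x := normal_pdf 0 1 (a^-1 * (x - c)) : R.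
have mg : measurable_fun [set: R] g.
  apply: measurableT_comp; first exact: measurable_normal_pdf.
  by apply: measurable_funM => //; exact: measurable_funB.
have gE x : normal_pdf 0 1 x * expR ((x ^+ 2 - (a^-1 * (x - c)) ^+ 2) / 2) = g x.
  rewrite /g normal_pdfE ?oner_neq0// /normal_fun -mulrA -expRD; congr (_ * expR _).
  by rewrite !subr0 expr1n; lra.
rewrite [RHS]ge0_integral_normal; first last.
- by move=> x; rewrite mule_ge0// lee_fin mulr_ge0 ?expR_ge0.
- apply: emeasurable_funM => //; apply/measurable_EFinP/measurable_funM => //.
  apply: measurableT_comp => //; apply: measurable_funM => //.
  apply: measurable_funB; first exact: measurable_funX.
  by apply: measurable_funX; apply: measurable_funM => //; exact: measurable_funB.
rewrite [LHS]ge0_integral_normal//; last first.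
  apply: measurableT_comp => //.
  by apply: measurable_funD => //; exact: measurable_funM.
pose h y := (f y * (g y)%:E)%E.
transitivity (\int[lebesgue_measure]_x h (a * x + c)%R)%E.
  by apply: eq_integral => x _ /=; rewrite /h /g addrK mulKf.
rewrite ge0_integral_affine//; first last.
- by move=> x; rewrite mule_ge0// lee_fin normal_pdf_ge0.
- by apply: emeasurable_funM => //; exact/measurable_EFinP.
rewrite -ge0_integralZl//; first last.
- by move=> x _; rewrite mule_ge0// lee_fin normal_pdf_ge0.
- by apply: emeasurable_funM => //; exact/measurable_EFinP.
apply: eq_integral => x _; rewrite /h muleCA -!muleA -!EFinM -gE.
by congr (_ * _%:E)%E; ring.
Qed.

(** * Change of variables for the standard Gaussian *)

Definition cvec (R : realType) (m : nat)
    (x : m.-tuple (measurableTypeR R)) : 'cV[R]_m := \col_i tnth x i.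

Definition tup (R : realType) (m : nat) (v : 'cV[R]_m) :
  m.-tuple (measurableTypeR R) := [tuple v i 0 | i < m].

Lemma cvecK (R : realType) m : cancel (@cvec R m) (@tup R m).
Proof. by move=> x; apply: eq_from_tnth => i; rewrite tnth_mktuple mxE. Qed.

Lemma tupK (R : realType) m : cancel (@tup R m) (@cvec R m).
Proof. by move=> v; apply/colP => i; rewrite mxE tnth_mktuple. Qed.

Lemma linmapE (R : realType) m (A : 'M[R]_m) x : linmap A x = tup (A *m cvec x).
Proof.
apply: eq_from_tnth => i; rewrite !tnth_mktuple mxE.
by apply: eq_bigr => j _; rewrite mxE.
Qed.

Lemma cvec_cons (R : realType) m (x : R) y :
  cvec (tcons (x, y)) = col_mx x%:M (cvec y) :> 'cV[R]_(1 + m).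
Proof.
apply/colP => i; rewrite [LHS]mxE [RHS]mxE; case: splitP => j ij.
  by rewrite mxE !ord1 mulr1n (_ : i = ord0)//; apply/val_inj; rewrite /= ij ord1.
by rewrite mxE (_ : i = lift ord0 j) ?tnthS//; exact/val_inj.
Qed.

Lemma tup_col_mx (R : realType) m (x : R) (v : 'cV[R]_m) :
  tup (col_mx x%:M v : 'cV[R]_(1 + m)) = tcons (x, tup v).
Proof. by rewrite -{1}[v]tupK -cvec_cons cvecK. Qed.

Lemma measurable_tup_affine (R : realType) m k (A : 'M[R]_(k, m)) (c : 'cV[R]_k) :
  measurable_fun setT (fun x : m.-tuple (measurableTypeR R) => tup (A *m cvec x + c)).
Proof.
apply/measurable_fun_tnthP => i.
rewrite (_ : _ \o _ = fun x => \sum_(j < m) A i j * tnth x j + c i 0).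
  apply: measurable_funD => //.
  apply: measurable_sum => j; apply: measurable_funM => //.
  exact: measurable_tnth.
apply/funext => x /=; rewrite tnth_mktuple !mxE; congr (_ + _).
by apply: eq_bigr => j _; rewrite mxE.
Qed.

Definition sqn (R : realType) m (v : 'cV[R]_m) : R := \sum_i v i 0 ^+ 2.

Lemma sqnE (R : realType) m (v : 'cV[R]_m) : sqn v = (v^T *m v) 0 0.
Proof. by rewrite mxE; apply: eq_bigr => i _; rewrite mxE expr2. Qed.

Lemma sqn_col_mx (R : realType) m (x : R) (v : 'cV[R]_m) :
  sqn (col_mx x%:M v : 'cV[R]_(1 + m)) = x ^+ 2 + sqn v.
Proof.
rewrite /sqn big_split_ord big_ord1 col_mxEu mxE mulr1n; congr (_ + _).
by apply: eq_bigr => i _; rewrite col_mxEd.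
Qed.

Lemma measurable_sqn_affine (R : realType) m k (A : 'M[R]_(k, m)) (c : 'cV[R]_k) :
  measurable_fun setT (fun x : m.-tuple (measurableTypeR R) => sqn (A *m cvec x + c)).
Proof.
apply: measurable_sum => i; apply: measurable_funX.
have /measurable_fun_tnthP/(_ i) := measurable_tup_affine A c.
by rewrite (_ : _ \o _ = fun x => (A *m cvec x + c) i 0)//; apply/funext => x /=; rewrite tnth_mktuple.
Qed.

Lemma ge0_integral_std_gaussianS (R : realType) m
    (f : m.+1.-tuple (measurableTypeR R) -> \bar R) :
  measurable_fun setT f -> (forall x, (0 <= f x)%E) ->
  (\int[std_gaussian R m.+1]_z f z =
   \int[normal_prob (0 : R) 1]_x \int[std_gaussian R m]_y f (tcons (x, y)))%E.
Proof.
move=> mf f0; rewrite [LHS]ge0_integral_distribution//.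
rewrite -(fubini_tonelli1 (m1 := normal_prob (0 : R) 1) (m2 := std_gaussian R m) (f \o @tcons R m))//.
  by apply: measurableT_comp => //; exact: measurable_tcons.
by move=> z; exact: f0.
Qed.

Lemma ge0_integral_std_gaussianS_swap (R : realType) m
    (f : m.+1.-tuple (measurableTypeR R) -> \bar R) :
  measurable_fun setT f -> (forall x, (0 <= f x)%E) ->
  (\int[std_gaussian R m.+1]_z f z =
   \int[std_gaussian R m]_y \int[normal_prob (0 : R) 1]_x f (tcons (x, y)))%E.
Proof.
move=> mf f0; rewrite [LHS]ge0_integral_distribution//.
rewrite -(fubini_tonelli2 (m1 := normal_prob (0 : R) 1) (m2 := std_gaussian R m) (f \o @tcons R m))//.
  by apply: measurableT_comp => //; exact: measurable_tcons.
by move=> z; exact: f0.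
Qed.

(** The density, with respect to the standard Gaussian law of [Z], of the law
    of [A Z + c]. *)
Definition affine_density (R : realType) m (A : 'M[R]_m) (c : 'cV[R]_m)
    (z : m.-tuple (measurableTypeR R)) : R :=
  `|\det A|^-1 * expR ((sqn (cvec z) - sqn (invmx A *m (cvec z - c))) / 2).

Lemma affine_density_ge0 (R : realType) m (A : 'M[R]_m) c z :
  0 <= affine_density A c z.
Proof. by rewrite mulr_ge0 ?expR_ge0// invr_ge0. Qed.

Lemma measurable_affine_density (R : realType) m (A : 'M[R]_m) c :
  measurable_fun setT (affine_density A c).
Proof.
apply: measurable_funM => //; apply: measurableT_comp => //.
apply: measurable_funM => //; apply: measurable_funB.
  rewrite (_ : (fun x => _) = fun x => sqn (1%:M *m cvec x + 0)).
    exact: measurable_sqn_affine.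
  by apply/funext => x; rewrite mul1mx addr0.
rewrite (_ : (fun x => _) = fun x => sqn (invmx A *m cvec x + - (invmx A *m c))).
  exact: measurable_sqn_affine.
by apply/funext => x; rewrite mulmxBr.
Qed.

Definition changes_variables (R : realType) m (A : 'M[R]_m) (c : 'cV[R]_m) :=
  forall f : m.-tuple (measurableTypeR R) -> \bar R,
    measurable_fun setT f -> (forall x, (0 <= f x)%E) ->
  (\int[std_gaussian R m]_z f (tup (A *m cvec z + c)) =
   \int[std_gaussian R m]_z (f z * (affine_density A c z)%:E))%E.

Lemma invmx_mul (F : fieldType) m (A B : 'M[F]_m) :
  A \in unitmx -> B \in unitmx -> invmx (A *m B) = invmx B *m invmx A.
Proof.
move=> uA uB; have uAB : A *m B \in unitmx by rewrite unitmx_mul uA.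
by apply: (can_inj (mulKmx uAB)); rewrite mulmxV// -mulmxA mulKVmx// mulmxV.
Qed.

(** Densities multiply along a composition: the squared norm of the
    intermediate point cancels between the two exponents. *)
Lemma changes_variables_comp (R : realType) m (A B : 'M[R]_m) (c d : 'cV[R]_m) :
  A \in unitmx -> B \in unitmx ->
  changes_variables A c -> changes_variables B d ->
  changes_variables (A *m B) (A *m d + c).
Proof.
move=> uA uB hA hB f mf f0.
pose g (y : m.-tuple (measurableTypeR R)) := f (tup (A *m cvec y + c)).
have mg : measurable_fun setT g.
  exact: measurableT_comp mf (measurable_tup_affine A c).
have g0 x : (0 <= g x)%E by exact: f0.
have gE z : f (tup (A *m B *m cvec z + (A *m d + c))) = g (tup (B *m cvec z + d)).
  by rewrite /g tupK mulmxDr mulmxA addrA.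
under eq_integral => z _ do rewrite gE.
rewrite (hB g mg g0).
(* [w] is the density of the inner map pulled back along the outer one *)
pose w (y : m.-tuple (measurableTypeR R)) :=
  affine_density B d (tup (invmx A *m cvec y + - (invmx A *m c))).
have mw : measurable_fun setT w.
  exact: measurableT_comp (measurable_affine_density B d) (measurable_tup_affine _ _).
pose h y := (f y * (w y)%:E)%E.
have mh : measurable_fun setT h.
  by apply: emeasurable_funM => //; exact/measurable_EFinP.
have h0 x : (0 <= h x)%E by rewrite /h mule_ge0// lee_fin affine_density_ge0.
have hE z : (g z * (affine_density B d z)%:E)%E = h (tup (A *m cvec z + c)).
  by rewrite /h/w/g tupK mulmxDr (mulKmx uA) addrK cvecK.
apply: (eq_trans (eq_integral _ _ (fun z _ => hE z))).
apply: (eq_trans (hA h mh h0)).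
apply: eq_integral => z _; rewrite /h/w -muleA -EFinM; congr (_ * _%:E)%E.
rewrite /affine_density tupK mulrACA -expRD -invfM -normrM mulrC.
rewrite det_mulmx [in RHS]mulrC; congr (expR _ * _^-1); last by rewrite mulrC.
rewrite (invmx_mul uA uB) -mulmxA.
have -> : cvec z - (A *m d + c) = (cvec z - c) - A *m d by rewrite opprD addrA addrAC.
by rewrite (mulmxBr (invmx A) (cvec z - c)) (mulKmx uA) !(mulmxBr (invmx A) (cvec z) c); ring.
Qed.

Lemma measurable_tcons1 (R : realType) m (y : m.-tuple (measurableTypeR R)) :
  measurable_fun setT (fun x => tcons (x, y)).
Proof. exact: measurableT_comp (@measurable_tcons R m) (pair2_measurable y). Qed.

Lemma measurable_tcons2 (R : realType) m (x : measurableTypeR R) :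
  measurable_fun setT (fun y : m.-tuple (measurableTypeR R) => tcons (x, y)).
Proof. exact: measurableT_comp (@measurable_tcons R m) (pair1_measurable x). Qed.

(** For a fixed tail, the first coordinate undergoes an affine map of the real
    line whose shift depends on that tail. *)
Lemma changes_variables_head (R : realType) m (a c : R) (b : 'rV[R]_m) :
  a != 0 ->
  changes_variables (block_mx a%:M b 0 1%:M : 'M[R]_(1 + m)) (col_mx c%:M 0 : 'cV[R]_(1 + m)).
Proof.
move=> a0 f mf f0; set U : 'M[R]_(1 + m) := block_mx _ _ _ _; set C := col_mx _ _.
have detU : \det U = a by rewrite det_ublock det1 mulr1 det_mx11 mxE mulr1n.
have uU : U \in unitmx by rewrite unitmxE detU unitfE.
pose e (y : m.-tuple (measurableTypeR R)) := (b *m cvec y) 0 0 + c.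
have UE (x : R) y : tup (U *m cvec (tcons (x, y)) + C) = tcons (a * x + e y, y).
  rewrite /C cvec_cons mul_block_col mul0mx add0r mul1mx add_col_mx addr0.
  have -> : a%:M *m x%:M + b *m cvec y + c%:M = (a * x + e y)%:M.
    by rewrite [b *m _]mx11_scalar -scalar_mxM -!raddfD /= addrA.
  by rewrite tup_col_mx cvecK.
have UV (x : R) y : invmx U *m (cvec (tcons (x, y)) - C) =
    col_mx (a^-1 * (x - e y))%:M (cvec y) :> 'cV[R]_(1 + m).
  rewrite -[RHS](mulKmx uU); congr (_ *m _).
  rewrite /C cvec_cons mul_block_col mul0mx add0r mul1mx opp_col_mx [LHS](@add_col_mx _ 1 m 1) subr0.
  congr col_mx; rewrite [b *m _]mx11_scalar -scalar_mxM -raddfB -raddfD /=.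
  by congr (_%:M); rewrite mulVKf// /e; ring.
have dE (x : R) y : affine_density U C (tcons (x, y)) =
    `|a|^-1 * expR ((x ^+ 2 - (a^-1 * (x - e y)) ^+ 2) / 2).
  rewrite /affine_density detU UV cvec_cons !sqn_col_mx.
  by rewrite opprD addrACA subrr addr0.
rewrite [LHS]ge0_integral_std_gaussianS_swap//; last first.
  exact: measurableT_comp mf (measurable_tup_affine U C).
rewrite [RHS]ge0_integral_std_gaussianS_swap; first last.
- by move=> x; rewrite mule_ge0// lee_fin affine_density_ge0.
- apply: emeasurable_funM => //; apply/measurable_EFinP.
  exact: measurable_affine_density.
apply: eq_integral => y _.
under eq_integral => x _ do rewrite UE.
have mfy := measurableT_comp mf (measurable_tcons1 y).
rewrite (ge0_integral_normal_affine (e y) a0 mfy (fun x => f0 (tcons (x, y)))).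
by apply: eq_integral => x _; rewrite dE.
Qed.

(** For a fixed first coordinate [x], the tail undergoes the affine map with
    linear part [L] and shift [x *: g + c]. This is why translations are needed
    even when only linear maps are of interest. *)
Lemma changes_variables_tail (R : realType) m (g c : 'cV[R]_m) (L : 'M[R]_m) :
  L \in unitmx -> (forall e, changes_variables L e) ->
  changes_variables (block_mx 1%:M 0 g L : 'M[R]_(1 + m)) (col_mx 0 c : 'cV[R]_(1 + m)).
Proof.
move=> uL IH f mf f0; set U : 'M[R]_(1 + m) := block_mx _ _ _ _; set C := col_mx _ _.
have detU : \det U = \det L by rewrite det_lblock det1 mul1r.
have uU : U \in unitmx by rewrite unitmxE detU -unitmxE.
pose e (x : R) := x *: g + c.
have UE (x : R) y : tup (U *m cvec (tcons (x, y)) + C) = tcons (x, tup (L *m cvec y + e x)).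
  rewrite /C cvec_cons mul_block_col mul0mx addr0 mul1mx add_col_mx addr0.
  by rewrite -tup_col_mx mul_mx_scalar [x *: g + _]addrC addrA.
have UV (x : R) y : invmx U *m (cvec (tcons (x, y)) - C) =
    col_mx x%:M (invmx L *m (cvec y - e x)) :> 'cV[R]_(1 + m).
  rewrite -[RHS](mulKmx uU); congr (_ *m _).
  rewrite /C cvec_cons mul_block_col mul0mx addr0 mul1mx opp_col_mx [LHS](@add_col_mx _ 1 m 1) subr0.
  by rewrite (mulKVmx uL) mul_mx_scalar /e opprD (addrA (cvec y)) (addrA (x *: g)) subrKC.
have dE (x : R) y : affine_density U C (tcons (x, y)) = affine_density L (e x) y.
  rewrite /affine_density detU UV cvec_cons !sqn_col_mx.
  by rewrite opprD addrACA subrr add0r.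
rewrite [LHS]ge0_integral_std_gaussianS//; last first.
  exact: measurableT_comp mf (measurable_tup_affine U C).
rewrite [RHS]ge0_integral_std_gaussianS; first last.
- by move=> x; rewrite mule_ge0// lee_fin affine_density_ge0.
- apply: emeasurable_funM => //; apply/measurable_EFinP.
  exact: measurable_affine_density.
apply: eq_integral => x _.
under eq_integral => y _ do rewrite UE.
have mfx := measurableT_comp mf (measurable_tcons2 x).
rewrite (IH (e x) _ mfx (fun y => f0 (tcons (x, y)))).
by apply: eq_integral => y _; rewrite dE.
Qed.

(** One step of Gaussian elimination, arranged so that the two factors are those
    of [changes_variables_tail] and [changes_variables_head]. *)
Lemma block_mx_pivot (F : fieldType) m (B : 'M[F]_(1 + m)) :
  B 0 0 != 0 ->
  exists (g : 'cV[F]_m) (L : 'M[F]_m), B =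
    (block_mx 1%:M 0 g L : 'M[F]_(1 + m)) *m
    (block_mx (B 0 0)%:M (ursubmx B) 0 1%:M : 'M[F]_(1 + m)).
Proof.
move=> B0; set a := B 0 0 in B0 *.
exists (a^-1 *: dlsubmx B), (drsubmx B - a^-1 *: dlsubmx B *m ursubmx B).
rewrite mulmx_block !mul1mx !mul0mx !mulmx0 !mulmx1 !addr0.
rewrite mul_mx_scalar scalerA mulfV// scale1r [_ + (_ - _)]addrC subrK.
rewrite -[LHS]submxK; congr block_mx.
by rewrite [LHS]mx11_scalar !mxE; congr (B _ _)%:M; exact/val_inj.
Qed.

(** A column of an invertible matrix is nonzero, so a zero pivot can be repaired
    by adding a lower row to the first one. *)
Lemma unitmx_pivot (F : fieldType) m (A : 'M[F]_(1 + m)) :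
  A \in unitmx -> A 0 0 = 0 -> exists i : 'I_m,
    ((block_mx 1%:M (delta_mx 0 i) 0 1%:M : 'M[F]_(1 + m)) *m A) 0 0 != 0.
Proof.
move=> uA A00.
have ul0 : ulsubmx A = 0.
  by apply/matrixP => i j; rewrite !ord1 !mxE -A00; congr (A _ _); exact/val_inj.
have [i Ai] : exists i, dlsubmx A i 0 != 0.
  apply/existsP; apply: contraTT uA; rewrite negb_exists => /forallP dl0.
  have -> : A = block_mx 0 (ursubmx A) 0 (drsubmx A).
    rewrite -[LHS]submxK ul0; congr block_mx.
    by apply/colP => i; move: (dl0 i); rewrite negbK => /eqP ->; rewrite mxE.
  by rewrite unitmxE det_ublock det_mx11 mxE mul0r unitr0.
exists i; rewrite -[A]submxK mulmx_block ul0 mulmx0 add0r -rowE.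
rewrite (_ : 0 = lshift m 0 :> 'I_(1 + m)); last exact/val_inj.
by rewrite block_mxEul mxE.
Qed.

Lemma block_mx_transvectionK (F : fieldType) m (b : 'rV[F]_m) :
  (block_mx 1%:M (- b) 0 1%:M : 'M[F]_(1 + m)) *m
  (block_mx 1%:M b 0 1%:M : 'M[F]_(1 + m)) = 1%:M.
Proof.
rewrite mulmx_block !mul1mx !mul0mx !mulmx0 !mulmx1 !addr0 add0r subrr.
by rewrite scalar_mx_block.
Qed.

Lemma changes_variables_unit (R : realType) m (A : 'M[R]_m) (c : 'cV[R]_m) :
  A \in unitmx -> changes_variables A c.
Proof.
elim: m A c => [|m IH] A c uA.
  move=> f mf f0; apply: eq_integral => z _.
  have -> : tup (A *m cvec z + c) = z by apply: eq_from_tnth => -[].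
  rewrite /affine_density det_mx00 normr1 invr1.
  by rewrite /sqn !big_ord0 subrr mul0r expR0 mulr1 mule1.
rewrite -[m.+1]/(1 + m)%N in A c uA *.
have pivot (B : 'M[R]_(1 + m)) (e : 'cV[R]_(1 + m)) :
    B \in unitmx -> B 0 0 != 0 -> changes_variables B e.
  move=> uB B00; have [g [L BE]] := block_mx_pivot B00.
  set U2 := (X in X *m _) in BE; set U1 := (X in _ *m X) in BE.
  have : U2 *m U1 \in unitmx by rewrite -BE.
  rewrite unitmx_mul => /andP[uU2 uU1].
  have uL : L \in unitmx by move: uU2; rewrite !unitmxE det_lblock det1 mul1r.
  (* the second shift corrects what the outer factor does to the first one *)
  pose e1 := usubmx e 0 0; pose e2 := dsubmx e - e1 *: g.
  have eE : e = U2 *m col_mx e1%:M 0 + col_mx 0 e2.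
    rewrite mul_block_col !mulmx0 !addr0 mul1mx add_col_mx addr0.
    by rewrite mul_mx_scalar addrC subrK -mx11_scalar vsubmxK.
  rewrite BE eE; apply: changes_variables_comp => //.
    by apply: changes_variables_tail => // ?; exact: IH.
  exact: changes_variables_head.
have [A00|] := eqVneq (A 0 0) 0; last exact: pivot.
have [i Ti] := unitmx_pivot uA A00.
set T := (X in (X *m A) _ _ != 0) in Ti.
have TT := block_mx_transvectionK (delta_mx 0 i : 'rV[R]_m).
set T' := (X in X *m _) in TT.
have uT : T \in unitmx by rewrite unitmxE det_ublock !det1 mulr1 unitr1.
have uT' : T' \in unitmx by rewrite unitmxE det_ublock !det1 mulr1 unitr1.
have -> : A = T' *m (T *m A) by rewrite mulmxA TT mul1mx.
have -> : c = T' *m (T *m c) + col_mx 0%:M 0.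
  by rewrite mulmxA TT mul1mx raddf0 col_mx0 addr0.
apply: changes_variables_comp => //.
- by rewrite unitmx_mul uT.
- by apply: changes_variables_head; rewrite oner_neq0.
- by apply: pivot => //; rewrite unitmx_mul uT.
Qed.

(** * Hyperplanes and second moments under the standard Gaussian *)

Lemma measurable_row_form (R : realType) m (b : 'rV[R]_m) :
  measurable_fun setT (fun z : m.-tuple (measurableTypeR R) => (b *m cvec z) 0 0).
Proof.
have /measurable_fun_tnthP/(_ 0) := measurable_tup_affine b 0.
rewrite (_ : _ \o _ = fun x => (b *m cvec x) 0 0)//.
by apply/funext => x /=; rewrite tnth_mktuple addr0.
Qed.

Lemma normal_prob_set1 (R : realType) (r : R) : normal_prob (0 : R) 1 [set r] = 0%E.
Proof.
have /null_content_dominatesP := @normal_prob_dominates R 0 1.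
by apply => //; exact: lebesgue_measure_set1.
Qed.

Lemma eq_indic (R : pzRingType) (T U : Type) (A : set T) (B : set U) x y :
  (A x <-> B y) -> \1_A x = \1_B y :> R.
Proof.
move=> AB; rewrite !indicE; congr (nat_of_bool _)%:R.
by apply/idP/idP; rewrite !in_setE => /AB.
Qed.

(** If the first coefficient of [b] is nonzero, every slice with a fixed tail is
    one point of the line; otherwise every slice with a fixed first coordinate
    is a hyperplane of one dimension less. *)
Lemma std_gaussian_hyperplane (R : realType) m (b : 'rV[R]_m) (c : R) :
  b != 0 -> std_gaussian R m [set z | (b *m cvec z) 0 0 = c] = 0%E.
Proof.
elim: m b c => [|m IH] b c b0; first by rewrite [b]thinmx0 eqxx in b0.
rewrite -[m.+1]/(1 + m)%N in b b0 *.
pose E n (b : 'rV[R]_n) c := [set z : n.-tuple (measurableTypeR R) | (b *m cvec z) 0 0 = c].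
have mE n (b' : 'rV[R]_n) c' : measurable (E n b' c').
  rewrite -[E _ _ _]setTI.
  exact: (measurable_row_form b' measurableT (measurable_set1 c')).
have EE (x : R) (y : m.-tuple (measurableTypeR R)) : ((b *m cvec (tcons (x, y)) : 'M[R]_1) 0 0 = c) =
    (lsubmx b 0 0 * x = c - (rsubmx b *m cvec y) 0 0).
  rewrite cvec_cons -{1}[b]hsubmxK mul_row_col mxE mul_mx_scalar mxE mulrC.
  by apply/propext; split=> [<-|->]; rewrite ?addrK ?subrK.
have mf : measurable_fun setT (fun z => (\1_(E _ b c) z)%:E : \bar R).
  apply/measurable_EFinP; apply: measurable_indic; exact: mE.
have f0 z : (0 <= (\1_(E _ b c) z)%:E :> \bar R)%E by rewrite lee_fin.
rewrite -[[set z | _]]/(E _ b c) -(setIT (E _ b c)) -integral_indic//; last exact: mE.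
have [l0|l0] := eqVneq (lsubmx b) 0; last first.
  rewrite ge0_integral_std_gaussianS_swap//; apply: integral0_eq => y _.
  set r := (c - (rsubmx b *m cvec y) 0 0) / lsubmx b 0 0.
  have l00 : lsubmx b 0 0 != 0.
    by apply: contra_neq l0 => l00; apply/matrixP => i j; rewrite !ord1 l00 mxE.
  rewrite -(normal_prob_set1 r) -(setIT [set r]) -integral_indic//.
  apply: eq_integral => x _; congr (_%:E); apply: eq_indic; rewrite /E/= EE.
  split=> [xE|->]; last by rewrite mulrC divfK.
  by rewrite /r -xE mulrC mulKf.
have r0 : rsubmx b != 0.
  by apply: contra_neq b0 => r0; rewrite -[b]hsubmxK l0 r0 row_mx0.
rewrite ge0_integral_std_gaussianS//; apply: integral0_eq => x _.
rewrite -(IH (rsubmx b) c r0) -[[set z | _]]/(E _ (rsubmx b) c).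
rewrite -(setIT (E _ (rsubmx b) c)) -integral_indic//; last exact: mE.
apply: eq_integral => y _; congr (_%:E); apply: eq_indic; rewrite /E/= EE l0 mxE mul0r.
by split=> [/eqP|->]; rewrite ?subrr// eq_sym subr_eq0 => /eqP.
Qed.

Lemma ge0_integral_linmap (R : realType) m (A : 'M[R]_m)
    (f : m.-tuple (measurableTypeR R) -> \bar R) :
  A \in unitmx -> measurable_fun setT f -> (forall x, (0 <= f x)%E) ->
  (\int[distribution (std_gaussian R m) (linmap A)]_z f z =
   \int[std_gaussian R m]_z (f z * (affine_density A 0 z)%:E))%E.
Proof.
move=> uA mf f0; rewrite [LHS]ge0_integral_distribution//.
rewrite -(changes_variables_unit 0 uA)//.
by apply: eq_integral => z _ /=; rewrite linmapE addr0.
Qed.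

Definition coord_scale (R : realType) m (i : 'I_m) (a : R) : 'M[R]_m :=
  diag_mx (\row_j (if j == i then a else 1)).

Lemma det_coord_scale (R : realType) m (i : 'I_m) (a : R) :
  \det (coord_scale i a) = a.
Proof.
rewrite det_diag (bigD1 i)//= mxE eqxx big1 ?mulr1// => j ji.
by rewrite mxE (negbTE ji).
Qed.

Lemma coord_scale_mulE (R : realType) m (i j : 'I_m) (a : R) (v : 'cV[R]_m) :
  (coord_scale i a *m v) j 0 = (if j == i then a else 1) * v j 0.
Proof. by rewrite mul_diag_mx !mxE. Qed.

Lemma affine_density_coord_scale (R : realType) m (i : 'I_m) (a : R) z :
  a != 0 -> affine_density (coord_scale i a) 0 z =
  `|a|^-1 * expR ((1 - a ^- 2) / 2 * tnth z i ^+ 2).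
Proof.
move=> a0; rewrite /affine_density det_coord_scale subr0.
have uD : coord_scale i a \in unitmx by rewrite unitmxE det_coord_scale unitfE.
have -> : invmx (coord_scale i a) *m cvec z = coord_scale i a^-1 *m cvec z.
  rewrite -[RHS](mulKmx uD); congr (_ *m _); apply/colP => j.
  by rewrite !coord_scale_mulE; case: ifP => _; rewrite ?mul1r// mulrA mulfV ?mul1r.
congr (_ * expR _); rewrite /sqn (bigD1 i)//= (bigD1 i (P := xpredT))//=.
rewrite opprD addrACA -sumrB big1 ?addr0; last first.
  by move=> j ji; rewrite coord_scale_mulE (negbTE ji) mul1r subrr.
by rewrite coord_scale_mulE eqxx !mxE exprMn -exprVn; ring.
Qed.

Lemma measurable_coord_sqr (R : realType) m (i : 'I_m) :
  measurable_fun setT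
    (fun z : m.-tuple (measurableTypeR R) => tnth z i ^+ 2 : R).
Proof. by apply: measurable_funX; exact: measurable_tnth. Qed.

(** The total mass of the image of the Gaussian under a coordinate scaling is
    one, which gives the moment generating function of the squared
    coordinate. *)
Lemma integral_expR_coord_sqr (R : realType) m (i : 'I_m) (a : R) : 0 < a ->
  (\int[std_gaussian R m]_z (expR ((1 - a ^- 2) / 2 * tnth z i ^+ 2))%:E = a%:E)%E.
Proof.
move=> a0; have an0 : a != 0 by rewrite gt_eqF.
have uD : coord_scale i a \in unitmx by rewrite unitmxE det_coord_scale unitfE.
have := ge0_integral_linmap (f := cst 1%E) uD (measurable_cst _) (fun=> lee01).
rewrite integral_cst//= probability_setT mule1.
under eq_integral => z _ do rewrite mul1e affine_density_coord_scale// EFinM.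
rewrite ge0_integralZl//=; last first.
  apply/measurable_EFinP; apply: measurableT_comp => //.
  by apply: measurable_funM => //; exact: measurable_coord_sqr.
move=> /(congr1 (fun x => a%:E * x)%E).
by rewrite gtr0_norm// mule1 muleA -EFinM mulfV// mul1e => <-.
Qed.

(** The variance is read off the generating function
    [E (expR ((1 - a ^- 2) / 2 * z_i ^+ 2)) = a] without differentiating it: the
    tangent inequality [1 + t <= expR t] bounds the second moment from above for
    [a > 1] and from below for [a < 1], and only the value 1 is compatible with
    all these bounds. *)
Lemma integral_coord_sqr (R : realType) m (i : 'I_m) :
  (\int[std_gaussian R m]_z (tnth z i ^+ 2)%:E = 1)%E.
Proof.
set M := (LHS).
have mz := @measurable_coord_sqr R m i.
have mzE : measurable_fun setT (fun z : m.-tuple (measurableTypeR R) => (tnth z i ^+ 2)%:E).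
  exact/measurable_EFinP.
have M0 : (0 <= M)%E by apply: integral_ge0 => z _; rewrite lee_fin sqr_ge0.
have mexp (t : R) : measurable_fun setT (fun z : m.-tuple (measurableTypeR R) => (expR (t * tnth z i ^+ 2))%:E).
  by apply/measurable_EFinP; apply: measurableT_comp => //; exact: measurable_funM.
have ZM (t : R) : 0 <= t -> (\int[std_gaussian R m]_z (t * tnth z i ^+ 2)%:E = t%:E * M)%E.
  move=> t0; under eq_integral => z _ do rewrite EFinM.
  by rewrite ge0_integralZl// => z _; rewrite lee_fin sqr_ge0.
(* both bounds are kept free of subtractions: finiteness of [M] is not known yet *)
have up a : 1 < a -> (1 + ((1 - a ^- 2) / 2)%:E * M <= a%:E)%E.
  move=> a1; set t := (_ / 2).
  have t0 : 0 <= t by rewrite divr_ge0// subr_ge0 invf_le1 ?exprn_ege1 ?exprn_gt0 ?ltW// (lt_trans ltr01).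
  rewrite -(integral_expR_coord_sqr i (lt_trans ltr01 a1)) -/t -ZM//.
  rewrite -[1%E](probability_setT (std_gaussian R m)) -[X in (X + _)%E]mul1e -integral_cst//.
  rewrite -ge0_integralD//.
  - apply: ge0_le_integral => //.
    + by move=> z _; rewrite adde_ge0//= lee_fin mulr_ge0// sqr_ge0.
    + by apply: emeasurable_funD => //; apply/measurable_EFinP; exact: measurable_funM.
    + by move=> z _; rewrite -EFinD lee_fin expR_ge1Dx.
  - by move=> z _; rewrite lee_fin mulr_ge0// sqr_ge0.
  - by apply/measurable_EFinP; exact: measurable_funM.
have dn a : 0 < a -> a < 1 -> (1 <= a%:E + ((a ^- 2 - 1) / 2)%:E * M)%E.
  move=> a0 a1; set t := (_ / 2).
  have t0 : 0 <= t by rewrite divr_ge0// subr_ge0 invf_ge1 ?exprn_ile1 ?exprn_gt0 ?ltW.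
  rewrite -(integral_expR_coord_sqr i a0) -ZM//.
  rewrite -[1%E](probability_setT (std_gaussian R m)) -[X in (X <= _)%E]mul1e -integral_cst//.
  rewrite -ge0_integralD//.
  - apply: ge0_le_integral => //.
    + by apply: emeasurable_funD => //; apply/measurable_EFinP; exact: measurable_funM.
    + move=> z _; rewrite -EFinD lee_fin -lerBlDr.
      rewrite (_ : (1 - a ^- 2) / 2 = - t); last by rewrite -mulNr opprB.
      by rewrite mulNr expR_ge1Dx.
  - by move=> z _; rewrite lee_fin mulr_ge0// sqr_ge0.
  - by apply/measurable_EFinP; exact: measurable_funM.
have Mfin : M \is a fin_num.
  rewrite ge0_fin_numE// ltey; apply: contraTneq (up 2 (ltr1n _ 2)) => ->.
  rewrite gt0_muley ?addey// lte_fin divr_gt0// subr_gt0 invf_lt1 ?exprn_gt0//.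
  by rewrite exprn_egt1// ltr1n.
have ME : M = (fine M)%:E by rewrite fineK.
set x := fine M in ME; have x0 : 0 <= x by rewrite -lee_fin -ME.
(* at [a = (1 + x) / 2] either bound amounts to [(a - 1) ^+ 2 <= 0] *)
pose a := (1 + x) / 2; have a0 : 0 < a by rewrite divr_gt0// ltr_pwDl.
have xE : x = 2 * a - 1 by rewrite /a; lra.
have sq : (1 - a ^- 2) / 2 * x + 1 - a = ((a - 1) / a) ^+ 2 / 2.
  by rewrite xE; field; rewrite gt_eqF.
have sq0 : (1 - a ^- 2) / 2 * x + 1 - a <= 0 -> a = 1.
  rewrite sq; apply: contraPeq => /eqP a1; apply/negP; rewrite -ltNge.
  rewrite divr_gt0// exprn_even_gt0//= mulf_neq0//; first by rewrite subr_eq0; apply/eqP.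
  by rewrite invr_eq0 gt_eqF.
have a1 : a = 1.
  apply: sq0; have [a1|a1|->] := ltgtP a 1; last by rewrite expr1n invr1; lra.
    have := dn a a0 a1; rewrite ME -EFinM -EFinD lee_fin.
    by set b := a ^- 2; lra.
  have := up a a1; rewrite ME -EFinM -EFinD lee_fin.
  by set b := a ^- 2; lra.
by rewrite ME; congr (_%:E); rewrite xE a1; lra.
Qed.

(** Changing the sign of one coordinate preserves the Gaussian law; the mixed
    moments vanish for this reason. *)
Lemma distribution_coord_flip (R : realType) m (i : 'I_m) A :
  measurable A ->
  distribution (std_gaussian R m) (linmap (coord_scale i (-1))) A = std_gaussian R m A.
Proof.
move=> mA; have uD : coord_scale i (-1 : R) \in unitmx.
  by rewrite unitmxE det_coord_scale unitrN1.
rewrite -(setIT A) -!integral_indic// ge0_integral_linmap//; last first.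
  by apply/measurable_EFinP; exact: measurable_indic.
apply: eq_integral => z _; rewrite affine_density_coord_scale ?oppr_eq0 ?oner_neq0//.
by rewrite normrN1 sqrrN expr1n invr1 subrr !mul0r expR0 mulr1 mule1.
Qed.

Lemma measurable_coordM (R : realType) m (i j : 'I_m) :
  measurable_fun setT
    (fun z : m.-tuple (measurableTypeR R) => tnth z i * tnth z j : R).
Proof. by apply: measurable_funM; exact: measurable_tnth. Qed.

Lemma integrable_coordM (R : realType) m (i j : 'I_m) :
  (std_gaussian R m).-integrable setT (fun z => (tnth z i * tnth z j)%:E).
Proof.
have isq k : (std_gaussian R m).-integrable setT (fun z => (tnth z k ^+ 2)%:E).
  apply/integrableP; split; first by apply/measurable_EFinP; exact: measurable_coord_sqr.
  under eq_integral => z _ do rewrite gee0_abs ?lee_fin ?sqr_ge0//.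
  by rewrite integral_coord_sqr ltry.
apply: (le_integrable measurableT _ _ (integrableD measurableT (isq i) (isq j))).
  by apply/measurable_EFinP; exact: measurable_coordM.
move=> z _; rewrite -EFinD /= lee_fin; set x := tnth z i; set y := tnth z j.
rewrite [leRHS]ger0_norm ?addr_ge0 ?sqr_ge0// ler_norml.
have : 0 <= (x + y) ^+ 2 + x ^+ 2 + y ^+ 2 by rewrite !addr_ge0 ?sqr_ge0.
have : 0 <= (x - y) ^+ 2 + x ^+ 2 + y ^+ 2 by rewrite !addr_ge0 ?sqr_ge0.
by rewrite !sqrrD => h1 h2; apply/andP; split; lra.
Qed.

Lemma integral_coordM (R : realType) m (i j : 'I_m) :
  (\int[std_gaussian R m]_z (tnth z i * tnth z j)%:E = (i == j)%:R%:E)%E.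
Proof.
have [<-|ij] := eqVneq i j; first exact: integral_coord_sqr.
set C := (LHS).
have mz : measurable_fun setT (fun z : m.-tuple (measurableTypeR R) => (tnth z i * tnth z j)%:E).
  by apply/measurable_EFinP; exact: measurable_coordM.
have Cfin : C \is a fin_num by exact: integrable_fin_num (integrable_coordM R i j).
have flip z : (tnth (linmap (coord_scale i (-1)) z) i * tnth (linmap (coord_scale i (-1)) z) j)%:E =
   (- (tnth z i * tnth z j)%:E)%E :> \bar R.
  rewrite linmapE !tnth_mktuple !coord_scale_mulE eqxx eq_sym (negbTE ij) !mxE.
  by rewrite mulN1r mul1r mulNr.
have : C = (- C)%E.
  transitivity (\int[distribution (std_gaussian R m) (linmap (coord_scale i (-1)))]_z
      (tnth z i * tnth z j)%:E)%E.
    apply: eq_measure_integral => A mA _; exact/esym/distribution_coord_flip.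
  rewrite integral_distribution//; last first.
    rewrite (_ : _ \o _ = fun z => (- (tnth z i * tnth z j)%:E)%E); last exact/funext.
    exact: integrableN (integrable_coordM R i j).
  under eq_integral => z _ do rewrite /= flip.
  by rewrite integralN//; apply: integrable_add_def => //; exact: integrable_coordM.
rewrite -(fineK Cfin) -EFinN => -[h]; congr (_%:E); rewrite mulr0n; move: h; set c := fine C; lra.
Qed.

Lemma cvec_formE (R : realType) m (B : 'M[R]_m) (z : m.-tuple (measurableTypeR R)) :
  ((cvec z)^T *m B *m cvec z) 0 0 = \sum_i \sum_j B i j * (tnth z i * tnth z j).
Proof.
rewrite -mulmxA mxE; apply: eq_bigr => i _; rewrite !mxE mulr_sumr.
by apply: eq_bigr => j _; rewrite !mxE; ring.
Qed.

Lemma std_gaussian_form (R : realType) m (B : 'M[R]_m) :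
  (std_gaussian R m).-integrable setT (fun z => (((cvec z)^T *m B *m cvec z) 0 0)%:E) /\
  (\int[std_gaussian R m]_z (((cvec z)^T *m B *m cvec z) 0 0)%:E = (\tr B)%:E)%E.
Proof.
have i2 i j : (std_gaussian R m).-integrable setT (fun z => ((B i j)%:E * (tnth z i * tnth z j)%:E)%E).
  by apply: integrableZl => //; exact: integrable_coordM.
have i1 i : (std_gaussian R m).-integrable setT
    (fun z => (\sum_j (B i j)%:E * (tnth z i * tnth z j)%:E)%E).
  by apply: integrable_sum => // j _.
have -> : (fun z : m.-tuple (measurableTypeR R) => (((cvec z)^T *m B *m cvec z) 0 0)%:E) =
    (fun z => (\sum_i \sum_j (B i j)%:E * (tnth z i * tnth z j)%:E)%E).
  apply/funext => z; rewrite cvec_formE -sumEFin; apply: eq_bigr => i _.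
  by rewrite -sumEFin; apply: eq_bigr => j _; rewrite EFinM.
split; first by apply: integrable_sum => // i _.
rewrite integral_sum// /mxtrace -sumEFin; apply: eq_bigr => i _.
rewrite integral_sum// (bigD1 i)//= big1 ?adde0 => [|j ji].
  by rewrite integralZl ?integral_coordM ?eqxx ?mule1//; exact: integrable_coordM.
rewrite integralZl ?integral_coordM; last exact: integrable_coordM.
  by rewrite eq_sym (negbTE ji) mule0.
by [].
Qed.

(** * Divergence between Gaussian laws *)

(** A density given by a positive function may replace the Radon-Nikodym
    derivative, since the two agree [Q]-almost everywhere, hence
    [P]-almost everywhere. *)
Lemma KL_density d (T : measurableType d) (R : realType)
    (P Q : probability T R) (r : T -> R) :
  measurable_fun setT r -> (forall x, 0 < r x) ->
  (forall A, measurable A -> P A = \int[Q]_(x in A) (r x)%:E)%E ->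
  KL P Q = (\int[P]_x (ln (r x))%:E)%E.
Proof.
move=> mr r0 PE; have PQ : P `<< Q.
  apply/null_content_dominatesP => A mA QA.
  by rewrite [LHS]PE// null_set_integral//; apply/measurable_EFinP; exact: measurable_funTS.
rewrite /KL asboolT//; set f := Radon_Nikodym _ _.
have intf : Q.-integrable setT f by exact: Radon_Nikodym_integrable.
have mf : measurable_fun setT f := measurable_int _ intf.
have fr : ae_eq P setT f (EFin \o r).
  apply: (null_dominates_ae_eq measurableT PQ).
  apply: integral_ae_eq => //; first exact/measurable_EFinP.
  by move=> E _ mE; rewrite -Radon_Nikodym_integral// -PE.
apply: ae_eq_integral => //.
- apply/measurable_EFinP; apply: measurableT_comp => //.
  exact: measurableT_comp.
- by apply/measurable_EFinP; exact: measurableT_comp.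
- exact: (ae_eq_comp (fun x => (ln (fine x))%:E) fr).
Qed.

Lemma sqn_eq0 (R : realType) m (v : 'cV[R]_m) : (sqn v == 0) = (v == 0).
Proof.
apply/eqP/eqP => [v0|->]; last by rewrite /sqn big1// => i _; rewrite mxE expr0n.
apply/colP => i; rewrite mxE; apply/eqP; rewrite -sqrf_eq0; apply/eqP.
by apply: (psumr_eq0P _ v0) => // j _; rewrite sqr_ge0.
Qed.

Lemma posdefmx_psd (R : realType) m (S : 'M[R]_m) : posdefmx S -> psdmx S.
Proof.
move=> [symS posS]; split=> // x; have [->|x0] := eqVneq x 0; last exact/ltW/posS.
by rewrite mulmx0 mxE.
Qed.

Lemma posdefmx_unit (R : realType) m (S : 'M[R]_m) : posdefmx S -> S \in unitmx.
Proof.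
move=> [_ posS]; rewrite unitmxE unitfE; apply/det0P => -[v v0 vS].
have := posS v^T; rewrite trmxK vS mul0mx mxE ltxx; move/implyP.
by rewrite implybF negbK -trmx0 (inj_eq trmx_inj) (negbTE v0).
Qed.

Lemma covroot_unit (R : realType) m (S : 'M[R]_m) :
  posdefmx S -> covroot S \in unitmx.
Proof.
move=> pS; have : covroot S *m (covroot S)^T \in unitmx.
  by rewrite covrootE ?posdefmx_unit//; exact: posdefmx_psd.
by rewrite unitmx_mul => /andP[].
Qed.

Lemma posdefmx_det_gt0 (R : realType) m (S : 'M[R]_m) : posdefmx S -> 0 < \det S.
Proof.
move=> pS; have := posdefmx_unit pS; rewrite unitmxE unitfE lt_def => ->.
by rewrite -(covrootE (posdefmx_psd pS)) det_mulmx det_tr -expr2 sqr_ge0.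
Qed.

Lemma gaussian_hyperplane (R : realType) m (S : 'M[R]_m) (b : 'rV[R]_m) :
  gaussian S [set z | (b *m cvec z) 0 0 = 0] =
  std_gaussian R m [set z | (b *m covroot S *m cvec z) 0 0 = 0].
Proof.
rewrite -[LHS]/(std_gaussian R m (linmap (covroot S) @^-1` _)).
by congr (std_gaussian R m _); apply/seteqP; split=> z /=; rewrite linmapE tupK mulmxA.
Qed.

(** A vector [u] in the kernel of [S0] gives the hyperplane orthogonal to [u],
    which has probability one under [N(0, S0)] and zero under [N(0, S)]. *)
Lemma Idiv_singular (R : realType) m (S0 S : 'M[R]_m) :
  psdmx S0 -> ~ posdefmx S0 -> posdefmx S -> Idiv S0 S = +oo%E.
Proof.
move=> pS0 nS0 pS; rewrite /Idiv /KL asboolF// => /null_content_dominatesP.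
have [u u0 uS0] : exists2 u : 'cV[R]_m, u != 0 & (u^T *m S0 *m u) 0 0 = 0.
  apply: contrapT => h; apply: nS0; split=> [|u u0]; first by case: pS0.
  rewrite lt_def (proj2 pS0 u) andbT; apply/eqP => uS; apply: h; exists u => //.
have uA0 : u^T *m covroot S0 = 0.
  apply: trmx_inj; rewrite trmx0; apply/eqP; rewrite -sqn_eq0 sqnE trmxK.
  by rewrite trmx_mul trmxK mulmxA -(mulmxA u^T) covrootE// uS0.
have uA : u^T *m covroot S != 0.
  apply: contra_neq u0 => h; apply: trmx_inj; rewrite trmx0.
  by rewrite -[LHS](mulmxK (covroot_unit pS)) h mul0mx.
pose E := [set z : m.-tuple (measurableTypeR R) | (u^T *m cvec z) 0 0 = 0].
have mE : measurable E.
  by rewrite -[E]setTI; exact: (measurable_row_form _ measurableT (measurable_set1 0)).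
move=> /(_ E mE) S0E; have : gaussian S0 E = 0%E.
  by apply: S0E; rewrite [LHS]gaussian_hyperplane std_gaussian_hyperplane.
rewrite [gaussian S0 E]gaussian_hyperplane uA0 (_ : [set _ | _] = setT).
  by rewrite probability_setT => /eqP; rewrite onee_eq0.
by apply/seteqP; split=> // z _ /=; rewrite mul0mx mxE.
Qed.

(** The density of [N(0, S)] with respect to the standard Gaussian, not with
    respect to Lebesgue measure: hence the squared norm in the exponent and the
    absence of powers of [2 pi]. *)
Definition gaussian_density (R : realType) m (S : 'M[R]_m)
    (z : m.-tuple (measurableTypeR R)) : R :=
  (Num.sqrt (\det S))^-1 *
  expR ((sqn (cvec z) - ((cvec z)^T *m invmx S *m cvec z) 0 0) / 2).

(** The density does not depend on which root of [S] is taken. *)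
Lemma affine_density_root (R : realType) m (A S : 'M[R]_m) :
  A \in unitmx -> A *m A^T = S -> affine_density A 0 = gaussian_density S.
Proof.
move=> uA AS; apply/funext => z; rewrite /affine_density /gaussian_density subr0 -AS.
rewrite det_mulmx det_tr -expr2 sqrtr_sqr (sqnE (invmx A *m _)) trmx_mul.
have uAT : A^T \in unitmx by rewrite unitmx_tr.
by rewrite (invmx_mul uA uAT) trmx_inv !mulmxA.
Qed.

Lemma gaussian_density_gt0 (R : realType) m (S : 'M[R]_m) z :
  posdefmx S -> 0 < gaussian_density S z.
Proof. by move=> pS; rewrite mulr_gt0 ?expR_gt0// invr_gt0 sqrtr_gt0 posdefmx_det_gt0. Qed.

Lemma measurable_gaussian_density (R : realType) m (S : 'M[R]_m) :
  posdefmx S -> measurable_fun setT (gaussian_density S).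
Proof.
move=> pS; rewrite -(affine_density_root (covroot_unit pS) (covrootE (posdefmx_psd pS))).
exact: measurable_affine_density.
Qed.

Lemma ge0_integral_gaussian (R : realType) m (S : 'M[R]_m)
    (f : m.-tuple (measurableTypeR R) -> \bar R) :
  posdefmx S -> measurable_fun setT f -> (forall x, (0 <= f x)%E) ->
  (\int[gaussian S]_z f z =
   \int[std_gaussian R m]_z (f z * (gaussian_density S z)%:E))%E.
Proof.
move=> pS mf f0; rewrite -(affine_density_root (covroot_unit pS) (covrootE (posdefmx_psd pS))).
exact: (ge0_integral_linmap (covroot_unit pS)).
Qed.

(** The quotient of densities is written as an exponential, so that it is
    measurable and positive at once and its logarithm is immediate. *)
Lemma gaussian_ratio (R : realType) m (S1 S2 : 'M[R]_m) A :
  posdefmx S1 -> posdefmx S2 -> measurable A ->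
  (gaussian S1 A = \int[gaussian S2]_(z in A)
     (expR (ln (gaussian_density S1 z) - ln (gaussian_density S2 z)))%:E)%E.
Proof.
move=> pS1 pS2 mA; pose r z := expR (ln (gaussian_density S1 z) - ln (gaussian_density S2 z)).
have mr : measurable_fun setT r.
  apply: measurableT_comp => //.
  by apply: measurable_funB; apply: measurableT_comp => //; exact: measurable_gaussian_density.
rewrite integral_mkcond (ge0_integral_gaussian pS2); first last.
- by move=> z; rewrite patchE; case: ifPn => // _; rewrite lee_fin expR_ge0.
- apply/(measurable_restrictT _ mA); apply/measurable_EFinP.
  exact: measurable_funTS.
have -> : gaussian S1 A = (\int[gaussian S1]_z (\1_A z)%:E)%E.
  by rewrite integral_indic// setIT.
have mA1 : measurable_fun setT (fun z => (\1_A z)%:E : \bar R).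
  by apply/measurable_EFinP; exact: measurable_indic.
have A0 z : (0 <= (\1_A z)%:E :> \bar R)%E by rewrite lee_fin.
rewrite (ge0_integral_gaussian pS1 mA1 A0).
apply: eq_integral => z _; rewrite epatch_indic /= muleAC muleC; congr (_ * _)%E.
rewrite -EFinM expRD expRN !lnK ?posrE ?gaussian_density_gt0//.
by rewrite divfK// gt_eqF// gaussian_density_gt0.
Qed.

Lemma ln_gaussian_density (R : realType) m (S : 'M[R]_m) z : posdefmx S ->
  ln (gaussian_density S z) =
  (sqn (cvec z) - ((cvec z)^T *m invmx S *m cvec z) 0 0 - ln (\det S)) / 2.
Proof.
move=> pS; have d0 := posdefmx_det_gt0 pS.
have s0 : 0 < Num.sqrt (\det S) by rewrite sqrtr_gt0.
rewrite /gaussian_density lnM ?posrE ?invr_gt0 ?expR_gt0// expRK lnV ?posrE//.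
by rewrite -{2}(sqr_sqrtr (ltW d0)) lnXn//; lra.
Qed.

(** The logarithm of the likelihood ratio is a constant plus the quadratic form
    of [(S2^-1 - S1^-1) / 2], whose expectation under [N(0, S1)] is a trace. *)
Lemma Idiv_posdef (R : realType) m (S1 S2 : 'M[R]_m) :
  posdefmx S1 -> posdefmx S2 ->
  Idiv S1 S2 =
  ((ln (\det S2) - ln (\det S1) + \tr (invmx S2 *m S1) - m%:R) / 2)%:E.
Proof.
move=> pS1 pS2; rewrite /Idiv.
pose r z := expR (ln (gaussian_density S1 z) - ln (gaussian_density S2 z)).
have mln : measurable_fun setT (fun z => ln (gaussian_density S1 z) - ln (gaussian_density S2 z)).
  by apply: measurable_funB; apply: measurableT_comp => //; exact: measurable_gaussian_density.
rewrite (@KL_density _ _ _ _ _ r); first last.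
- by move=> A mA; exact: gaussian_ratio.
- by move=> z; exact: expR_gt0.
- exact: measurableT_comp.
set A := covroot S1.
pose c := (ln (\det S2) - ln (\det S1)) / 2.
pose B := 2^-1 *: (A^T *m (invmx S2 - invmx S1) *m A).
have lnrE z : ln (r (linmap A z)) = c + ((cvec z)^T *m B *m cvec z) 0 0.
  rewrite /r expRK !ln_gaussian_density// linmapE tupK.
  rewrite /B -scalemxAr -scalemxAl mulmxBr !mulmxBl mulmxBr mulmxBl !mulmxA -!trmx_mul !mxE /c.
  lra.
have [iB EB] := std_gaussian_form B.
have ic : (std_gaussian R m).-integrable setT (fun=> c%:E).
  exact: finite_measure_integrable_cst.
rewrite integral_distribution; first last.
- apply: (eq_integrable measurableT (fun z => (c%:E + (((cvec z)^T *m B *m cvec z) 0 0)%:E)%E)).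
    by move=> z _; rewrite /= lnrE EFinD.
  exact: integrableD.
- by apply/measurable_EFinP; under eq_fun => z do rewrite expRK.
under eq_integral => z _ do rewrite /= lnrE EFinD.
rewrite integralD// EB integral_cst// [X in (_ * X + _)%E]probability_setT mule1 -EFinD.
congr (_%:E); rewrite /B linearZ /= -mulmxA mxtrace_mulC -mulmxA.
rewrite covrootE; last exact: posdefmx_psd.
rewrite mulmxBl mulVmx ?posdefmx_unit// linearB /= mxtrace1 /c.
by set t := \tr _; lra.
Qed.

(** * Schur complements, nonnegativity, and the Pythagorean rule *)

Lemma posdefmx_congr (R : realType) m (V S : 'M[R]_m) :
  V \in unitmx -> posdefmx S -> posdefmx (V *m S *m V^T).
Proof.
move=> uV [symS posS]; split; first by rewrite !trmx_mul trmxK symS mulmxA.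
move=> x x0; have := posS (V^T *m x); rewrite trmx_mul trmxK !mulmxA; apply.
have uVT : V^T \in unitmx by rewrite unitmx_tr.
by apply: contra_neq x0 => h; rewrite -[x](mulKmx uVT) h mulmx0.
Qed.

Lemma posdefmx_ulsub (R : realType) n k (S : 'M[R]_(n + k)) :
  posdefmx S -> posdefmx (ulsubmx S).
Proof.
move=> [symS posS]; split; first by rewrite trmx_ulsub symS.
move=> x x0; have := posS (col_mx x 0).
rewrite -{1}[S]submxK tr_col_mx trmx0 mul_row_block mul_row_col.
rewrite !mul0mx !addr0 mulmx0 addr0; apply.
by apply: contra_neq x0 => /(congr1 usubmx); rewrite col_mxKu => ->; apply/colP => i; rewrite !mxE.
Qed.

Lemma posdefmx_drsub (R : realType) n k (S : 'M[R]_(n + k)) :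
  posdefmx S -> posdefmx (drsubmx S).
Proof.
move=> [symS posS]; split; first by rewrite trmx_drsub symS.
move=> x x0; have := posS (col_mx 0 x).
rewrite -{1}[S]submxK tr_col_mx trmx0 mul_row_block mul_row_col.
rewrite !mul0mx !add0r mulmx0 add0r; apply.
by apply: contra_neq x0 => /(congr1 dsubmx); rewrite col_mxKd => ->; apply/colP => i; rewrite !mxE.
Qed.

Lemma posdefmx_block_diag (R : realType) n k (P : 'M[R]_n) (W : 'M[R]_k) :
  posdefmx P -> posdefmx W -> posdefmx (block_mx P 0 0 W).
Proof.
move=> pP pW; have [symP posP] := pP; have [symW posW] := pW.
split; first by rewrite tr_block_mx !trmx0 symP symW.
move=> x; rewrite -[x]vsubmxK; set y := usubmx x; set z := dsubmx x => x0.
rewrite tr_col_mx mul_row_block mul_row_col !mulmx0 addr0 add0r mxE.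
have [y0|y0] := eqVneq y 0; last first.
  by rewrite ltr_pwDl ?posP//; exact: (proj2 (posdefmx_psd pW)).
rewrite ltr_wpDl ?posW//; first exact: (proj2 (posdefmx_psd pP)).
by apply: contra_neq x0 => z0; rewrite y0 z0 col_mx0.
Qed.

Definition shear_mx (R : realType) n k (K : 'M[R]_(k, n)) : 'M[R]_(n + k) :=
  block_mx 1%:M 0 K 1%:M.

Lemma det_shear_mx (R : realType) n k (K : 'M[R]_(k, n)) : \det (shear_mx K) = 1.
Proof. by rewrite det_lblock !det1 mulr1. Qed.

Lemma shear_mx_unit (R : realType) n k (K : 'M[R]_(k, n)) : shear_mx K \in unitmx.
Proof. by rewrite unitmxE det_shear_mx unitr1. Qed.

Lemma shear_mx_congr (R : realType) n k (K : 'M[R]_(k, n)) (A : 'M[R]_n) B C D :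
  shear_mx K *m block_mx A B C D *m (shear_mx K)^T =
  block_mx A (A *m K^T + B) (K *m A + C) ((K *m A + C) *m K^T + (K *m B + D)).
Proof.
rewrite tr_block_mx !trmx1 trmx0 !mulmx_block !mul1mx !mul0mx !addr0.
by rewrite !mulmx1 !mulmx0 !addr0.
Qed.

Lemma shear_mxK (R : realType) n k (K : 'M[R]_(k, n)) (S : 'M[R]_(n + k)) :
  shear_mx K *m (shear_mx (- K) *m S *m (shear_mx (- K))^T) *m (shear_mx K)^T = S.
Proof.
have KK : shear_mx K *m shear_mx (- K) = 1%:M.
  rewrite mulmx_block !mul1mx !mul0mx !mulmx0 !mulmx1 !addr0 add0r subrr.
  by rewrite scalar_mx_block.
by rewrite !mulmxA KK mul1mx -mulmxA -trmx_mul KK trmx1 mulmx1.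
Qed.

Lemma schur_decomposition (R : realType) n k (S : 'M[R]_(n + k)) :
  let K := dlsubmx S *m invmx (ulsubmx S) in
  let W := drsubmx S - K *m ursubmx S in
  posdefmx S -> posdefmx W /\
  S = shear_mx K *m block_mx (ulsubmx S) 0 0 W *m (shear_mx K)^T.
Proof.
move=> K W pS; have uP := posdefmx_unit (posdefmx_ulsub pS).
have KP : K *m ulsubmx S = dlsubmx S by rewrite /K mulmxKV.
have KT : ulsubmx S *m K^T = ursubmx S.
  have [symS _] := pS.
  by rewrite -[ursubmx S]trmxK trmx_ursub symS -KP (trmx_mul K) trmx_ulsub symS.
have SE : S = shear_mx K *m block_mx (ulsubmx S) 0 0 W *m (shear_mx K)^T.
  rewrite shear_mx_congr mulmx0 !addr0 add0r KP KT -[LHS]submxK /W.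
  by congr block_mx; rewrite -KP -mulmxA KT addrC subrK.
split=> //; have := posdefmx_congr (shear_mx_unit (- K)) pS.
rewrite {1}SE; have := shear_mxK (- K) (block_mx (ulsubmx S) 0 0 W).
rewrite opprK => ->.
by move=> /posdefmx_drsub; rewrite block_mxKdr.
Qed.

Lemma ln_le_subr1 (R : realType) (a : R) : 0 < a -> ln a <= a - 1 ?= iff (a == 1).
Proof.
move=> a0; have aE : a = expR (ln a) by rewrite lnK ?posrE.
split; first by rewrite lerBrDl {2}aE expR_ge1Dx.
apply/eqP/eqP => [h|->]; last by rewrite ln1 subrr.
have [l0|l0] := eqVneq (ln a) 0; first by rewrite aE l0 expR0.
by have := expR_gt1Dx l0; rewrite -aE h addrC subrK ltxx.
Qed.

(** Peeling off one row and column at a time: the determinant is the product of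
    the pivots [a], while the trace is the sum of the pivots plus the nonnegative
    terms [a * sqn K]. So [ln a <= a - 1] for each pivot gives the inequality,
    and equality forces all pivots to be 1 and all [K] to vanish. *)
Lemma ln_det_le_trace (R : realType) m (X : 'M[R]_m) : posdefmx X ->
  ln (\det X) <= \tr X - m%:R /\ (ln (\det X) = \tr X - m%:R -> X = 1%:M).
Proof.
elim: m X => [|m IH] X pX.
  split; last by move=> _; apply/matrixP => -[].
  by rewrite det_mx00 ln1 /mxtrace big_ord0 subrr.
rewrite -[m.+1]/(1 + m)%N in X pX *.
have [pW XE] := schur_decomposition pX.
set K := _ *m invmx _ in pW XE; set W := _ - _ in pW XE.
have pa := posdefmx_ulsub pX; set P := ulsubmx X in pa XE.
have PE : P = (P 0 0)%:M := mx11_scalar P.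
set a := P 0 0 in PE.
have a0 : 0 < a by have := posdefmx_det_gt0 pa; rewrite PE det_mx11 mxE mulr1n.
have detX : \det X = a * \det W.
  by rewrite XE !det_mulmx det_tr det_shear_mx det_ublock mul1r mulr1 PE det_mx11 mxE mulr1n.
have trX : \tr X = a + (a * sqn K + \tr W).
  rewrite XE shear_mx_congr mulmx0 !addr0 add0r mxtrace_block PE mxtrace_scalar mulr1n.
  rewrite linearD /= mxtrace_mulC mul_mx_scalar -scalemxAr linearZ /=.
  by rewrite trace_mx11 sqnE.
have [IH1 IH2] := IH _ pW.
have sK : 0 <= sqn K by apply: sumr_ge0 => i _; exact: sqr_ge0.
have aK : 0 <= a * sqn K by rewrite mulr_ge0// ltW.
have [la lae] := ln_le_subr1 a0.
rewrite detX trX lnM ?posrE ?posdefmx_det_gt0// -natr1.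
split; first by lra.
move=> h; have aK0 : a * sqn K = 0 by lra.
have a1 : a = 1 by apply/eqP; rewrite -lae; apply/eqP; lra.
have W1 : W = 1%:M by apply: IH2; lra.
have K0 : K = 0.
  by apply/eqP; rewrite -sqn_eq0; move/eqP: aK0; rewrite mulf_eq0 gt_eqF.
rewrite XE shear_mx_congr K0 PE a1 W1 trmx0 !mulmx0 !mul0mx !addr0 add0r.
by rewrite add0r [RHS]scalar_mx_block.
Qed.

Lemma Idiv_congr (R : realType) m (V S1 S2 : 'M[R]_m) : V \in unitmx ->
  posdefmx S1 -> posdefmx S2 ->
  Idiv (V *m S1 *m V^T) (V *m S2 *m V^T) = Idiv S1 S2.
Proof.
move=> uV p1 p2; rewrite !Idiv_posdef//; try exact: posdefmx_congr.
congr ((_ / _)%:E).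
have dV : 0 < \det V ^+ 2.
  by rewrite exprn_even_gt0//=; move: uV; rewrite unitmxE unitfE.
have detE (S : 'M[R]_m) : posdefmx S -> ln (\det (V *m S *m V^T)) = ln (\det V ^+ 2) + ln (\det S).
  move=> pS; rewrite !det_mulmx det_tr mulrAC -expr2 lnM ?posrE//.
  exact: posdefmx_det_gt0.
have u2 := posdefmx_unit p2; have uVT : V^T \in unitmx by rewrite unitmx_tr.
have uVS : V *m S2 \in unitmx by rewrite unitmx_mul uV.
have -> : \tr (invmx (V *m S2 *m V^T) *m (V *m S1 *m V^T)) = \tr (invmx S2 *m S1).
  rewrite (invmx_mul uVS uVT) (invmx_mul uV u2) mxtrace_mulC -!mulmxA (mulKVmx uVT).
  by rewrite mxtrace_mulC -!mulmxA (mulVmx uV) mulmx1 mxtrace_mulC.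
by rewrite !detE//; set t := \tr _; lra.
Qed.

(** In the coordinates where [S2] becomes the identity this is
    [ln_det_le_trace]. *)
Lemma Idiv_ge0 (R : realType) m (S1 S2 : 'M[R]_m) :
  posdefmx S1 -> posdefmx S2 ->
  (0 <= Idiv S1 S2)%E /\ (Idiv S1 S2 = 0%E -> S1 = S2).
Proof.
move=> p1 p2; set A := covroot S2.
have uA : A \in unitmx := covroot_unit p2.
have AA : A *m A^T = S2 by exact/covrootE/posdefmx_psd.
have uA' : invmx A \in unitmx by rewrite unitmx_inv.
set X := invmx A *m S1 *m (invmx A)^T.
have pX : posdefmx X by exact: posdefmx_congr.
have XE : S1 = A *m X *m A^T.
  by rewrite /X !mulmxA mulmxV// mul1mx -mulmxA -trmx_mul mulmxV// trmx1 mulmx1.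
have p1m : posdefmx (1%:M : 'M[R]_m).
  have -> : 1%:M = invmx A *m S2 *m (invmx A)^T.
    by rewrite -AA !mulmxA mulVmx// mul1mx -trmx_mul mulVmx// trmx1.
  exact: posdefmx_congr.
have -> : Idiv S1 S2 = Idiv X 1%:M by rewrite -(Idiv_congr uA pX p1m) mulmx1 AA -XE.
rewrite Idiv_posdef// invmx1 mul1mx det1 ln1 sub0r lee_fin.
have [le eq] := ln_det_le_trace pX; split.
  by rewrite divr_ge0//; move: le; set t := \tr _; lra.
move=> -[h]; rewrite XE eq ?mulmx1//.
by move: h; set t := \tr _; lra.
Qed.

Lemma Idiv_refl (R : realType) m (S : 'M[R]_m) : posdefmx S -> Idiv S S = 0%E.
Proof.
move=> pS; rewrite Idiv_posdef// mulVmx ?posdefmx_unit// mxtrace1.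
by rewrite subrr add0r subrr mul0r.
Qed.

(** For a block diagonal second argument, the block [W] contributes
    [ln (det W) + tr (W^-1 T22)] to the divergence, independently of the other
    diagonal block; this cancels from the difference of the two sides. *)
Lemma Idiv_block_diag (R : realType) n k (T : 'M[R]_(n + k)) (P : 'M[R]_n) (W : 'M[R]_k) :
  posdefmx T -> posdefmx P -> posdefmx W ->
  Idiv T (block_mx P 0 0 W) =
  (Idiv T (block_mx (ulsubmx T) 0 0 W) + Idiv (ulsubmx T) P)%E.
Proof.
move=> pT pP pW; have pQ := posdefmx_ulsub pT; set Q := ulsubmx T in pQ *.
have JE (P' : 'M[R]_n) : posdefmx P' ->
    (ln (\det (block_mx P' 0 0 W)) = ln (\det P') + ln (\det W)) /\
    (\tr (invmx (block_mx P' 0 0 W) *m T) = \tr (invmx P' *m Q) + \tr (invmx W *m drsubmx T)).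
  move=> pP'; split; first by rewrite det_ublock lnM ?posrE ?posdefmx_det_gt0//.
  rewrite invmx_block_diag; last exact/posdefmx_unit/posdefmx_block_diag.
  by rewrite -{1}[T]submxK mulmx_block !mul0mx !addr0 !add0r mxtrace_block.
have [dP tP] := JE P pP; have [dQ tQ] := JE Q pQ.
rewrite !Idiv_posdef//; try exact: posdefmx_block_diag.
rewrite -EFinD dP dQ tP tQ mulVmx ?posdefmx_unit// mxtrace1 natrD; congr (_%:E).
by set t := \tr _; set u := \tr _; lra.
Qed.

Theorem proposition4p4 (R : realType) (n k : nat) (hk : (0 < k)%N)
    (hkn : (k < n)%N) (Sh : 'M[R]_n) (S : 'M[R]_(n + k))
    (hSh : posdefmx Sh) (hS : posdefmx S) :
  let S11 := ulsubmx S in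
  let S12 := ursubmx S in
  let S21 := dlsubmx S in
  let S22 := drsubmx S in
  let Sstar : 'M[R]_(n + k) :=
    block_mx Sh
             (Sh *m invmx S11 *m S12)
             (S21 *m invmx S11 *m Sh)
             (S22 - S21 *m invmx S11 *m (S11 - Sh) *m invmx S11 *m S12) in
  [/\ argmins (Sigma0 k Sh) (fun S0 => Idiv S0 S) = [set Sstar],
      posdefmx Sstar,
      Idiv Sstar S = Idiv Sh S11 &
      forall S0 : 'M[R]_(n + k), Sigma0 k Sh S0 -> posdefmx S0 ->
        Idiv S0 S = (Idiv S0 Sstar + Idiv Sstar S)%E].
Proof.
move=> S11 S12 S21 S22 Sstar.
have p11 : posdefmx S11 := posdefmx_ulsub hS.
have [pW SE] := schur_decomposition hS.
set K := _ *m invmx _ in pW SE; set W := _ - _ in pW SE.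
have KT : K^T = invmx S11 *m S12.
  by rewrite trmx_mul trmx_inv trmx_ulsub trmx_dlsub (proj1 hS).
(* the same shear and Schur complement as for [S], with [Sh] in place of [S11] *)
have SstarE : Sstar = shear_mx K *m block_mx Sh 0 0 W *m (shear_mx K)^T.
  rewrite shear_mx_congr mulmx0 !addr0 add0r KT /Sstar !mulmxA.
  congr block_mx; rewrite -/K mulmxBr !mulmxBl /W -/S12 -/S22.
  by rewrite /K mulmxKV ?posdefmx_unit// opprB addrCA addrC.
have pstar : posdefmx Sstar.
  by rewrite SstarE; apply/posdefmx_congr/posdefmx_block_diag => //; exact: shear_mx_unit.
have decomp S0 : posdefmx S0 -> ulsubmx S0 = Sh ->
    Idiv S0 S = (Idiv S0 Sstar + Idiv Sh S11)%E.
  move=> pS0 ul0; set T := shear_mx (- K) *m S0 *m (shear_mx (- K))^T.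
  have pT : posdefmx T by apply: posdefmx_congr => //; exact: shear_mx_unit.
  have ulT : ulsubmx T = Sh.
    by rewrite /T -[S0]submxK shear_mx_congr block_mxKul.
  have pD (P : 'M[R]_n) : posdefmx P -> posdefmx (block_mx P 0 0 W).
    by move=> pP; exact: posdefmx_block_diag.
  have congrT D : posdefmx D ->
      Idiv S0 (shear_mx K *m D *m (shear_mx K)^T) = Idiv T D.
    by move=> pD'; rewrite -[S0](shear_mxK K) (Idiv_congr (shear_mx_unit K) pT pD').
  rewrite {1}SE SstarE (congrT _ (pD _ p11)) (congrT _ (pD _ hSh)).
  by rewrite (Idiv_block_diag pT p11 pW) ulT.
have ulstar : ulsubmx Sstar = Sh by rewrite block_mxKul.
have Istar : Idiv Sstar S = Idiv Sh S11.
  by rewrite decomp// Idiv_refl// add0e.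
have pyth S0 : Sigma0 k Sh S0 -> posdefmx S0 ->
    Idiv S0 S = (Idiv S0 Sstar + Idiv Sstar S)%E.
  by move=> [_ ul0] pS0; rewrite Istar; exact: decomp.
have fin : Idiv Sstar S \is a fin_num by rewrite Idiv_posdef.
split=> //; apply/seteqP; split=> [X [SX minX]|_ ->] /=; last first.
  split=> [|Y SY]; first by split=> //; exact: posdefmx_psd.
  have [pY|nY] := pselect (posdefmx Y).
    by rewrite [leRHS]pyth// leeDr//; have [] := Idiv_ge0 pY pstar.
  by rewrite (Idiv_singular (proj1 SY) nY hS) leey.
have := minX Sstar (conj (posdefmx_psd pstar) ulstar).
have [pX|nX] := pselect (posdefmx X); last first.
  by rewrite (Idiv_singular (proj1 SX) nX hS) leye_eq => /eqP h; rewrite h in fin.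
have [ge0 eq0] := Idiv_ge0 pX pstar.
rewrite (pyth X SX pX) -[leRHS]add0e leeD2rE// => le0; apply: eq0.
by apply/eqP; rewrite eq_le le0.
Qed.
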